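(* Let $\alpha$ be a Pisot number and $\lambda=\alpha^{-1}$. Let $\mu_\lambda$ be the Hutchinson measure on $\mathbb{R}^2$ of the IFS $\{\tau_b(x)=\lambda(x+b)\}_{b\in B}$ with $B=\{[0,0]^t,[1,0]^t,[0,1]^t\}$ and equal weights $1/3$. Then $\mu_\lambda$ is not absolutely continuous with respect to Lebesgue measure on $\mathbb{R}^2$; in fact, $\mu_\lambda$ is purely continuous and singular.
   Context: A Pisot number is an algebraic integer $\alpha>1$ (real) all of whose Galois conjugates other than $\alpha$ itself have modulus less than $1$. The Hutchinson measure of the contractive affine IFS $\{\tau_b\}_{b\in B}$ with equal weights is the unique Borel probability measure $\mu$ on $\mathbb{R}^2$ satisfying $\mu=\frac{1}{\#B}\sum_{b\in B}\mu\circ\tau_b^{-1}$. A measure is purely continuous and singular if its absolutely continuous part (with respect to Lebesgue measure) and its atomic part are both zero. *)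

(* Defs.v *)
From mathcomp Require Import all_boot all_order all_algebra.
From mathcomp Require Import complex.
From mathcomp Require Import all_classical all_reals all_analysis.

Set Implicit Arguments.
Unset Strict Implicit.
Unset Printing Implicit Defensive.

Import Order.TTheory GRing.Theory Num.Theory.

Local Open Scope classical_set_scope.
Local Open Scope ring_scope.
Local Open Scope complex_scope.

Section pisot.
Context (R : realType).
Implicit Type a : R.

Definition algebraic_integer a : Prop := integralOver (intr : int -> R) a.

Definition is_minimal_poly (p : {poly rat}) a : Prop :=
  [/\ p \is monic, irreducible_poly p & root (map_poly ratr p) a].

Definition galois_conjugate a (z : R[i]) : Prop :=
  exists2 p : {poly rat}, is_minimal_poly p a & root (map_poly ratr p) z.

Definition pisot a : Prop :=
  [/\ 1 < a, algebraic_integer a &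
      forall z : R[i], galois_conjugate a z -> z != a%:C -> `|z| < 1].

End pisot.

Section measures.
Context (d : measure_display) (T : measurableType d) (R : realType).
Local Open Scope ereal_scope.

Definition mutually_singular (m1 m2 : set T -> \bar R) : Prop :=
  exists N : set T, [/\ measurable N, m1 N = 0 & m2 (~` N) = 0].

(* The Lebesgue decomposition of mu with respect to ref is
   mu = nu + rho with nu `<< ref and rho singular to ref. *)
Definition is_abs_continuous_part
    (ref mu : set T -> \bar R) (nu : {measure set T -> \bar R}) : Prop :=
  nu `<< ref /\
  exists2 rho : {measure set T -> \bar R}, mutually_singular rho ref &
    forall A, measurable A -> mu A = nu A + rho A.

Definition atomic_part (mu : set T -> \bar R) : set T -> \bar R :=
  fun A => \esum_(x in A) mu [set x].

Definition purely_continuous_singular (ref mu : set T -> \bar R) : Prop :=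
  is_abs_continuous_part ref mu mzero /\
  forall A, measurable A -> atomic_part mu A = 0.

Definition is_hutchinson_measure (taus : seq (T -> T)) (mu : probability T R) :
    Prop :=
  forall A, measurable A ->
    mu A = (((size taus)%:R)^-1)%:E * \sum_(tau <- taus) pushforward mu tau A.

End measures.

(* The product sigma-algebra on the plane is its Borel sigma-algebra. *)
Notation plane R := (measurableTypeR R * measurableTypeR R)%type.

Section plane.
Context (R : realType).

Definition lebesgue2 : set (plane R) -> \bar R :=
  (@lebesgue_measure R \x @lebesgue_measure R)%E.

Definition digit_map (l : R) (b x : R * R) : R * R :=
  (l * (x.1 + b.1), l * (x.2 + b.2)).

Definition digits : seq (R * R) := [:: (0, 0); (1, 0); (0, 1)].

Definition digit_ifs (l : R) : seq (plane R -> plane R) :=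
  [seq digit_map l b | b <- digits].

End plane.

(* Main.v *)
From HB Require Import structures.
Require Import Defs.
From mathcomp Require Import all_boot all_order all_algebra.
From mathcomp Require Import complex polyorder finmap ring lra.
From mathcomp Require Import all_classical all_reals all_analysis.
From mathcomp Require Import measurable_realfun.

(* Under the first coordinate mu projects to the law m of sum_k alpha^-k X_k,
   where the X_k are independent, X_k = 0 with probability 2/3 and X_k = 1 with
   probability 1/3; it suffices to show that m is singular and has no atoms.
   Let Z be a Lebesgue-null set of maximal m-measure.  The restriction nu of m
   to the complement of Z is absolutely continuous and, as the contractions
   preserve null sets, satisfies the same self-similarity equation.  Its Fourier
   transform phi therefore satisfies
     |phi(alpha xi)|^2 = (5 + 4 cos xi) / 9 * |phi(xi)|^2.
   The factor never vanishes, and at xi = 2 pi alpha^j it is 1 - O(rho^|j|) for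
   some rho < 1 and all integers j: for j < 0 by continuity, for j >= 0 because
   the power sums of the conjugates of alpha are integers, so that alpha^j is
   exponentially close to an integer.  Hence |phi(2 pi alpha^n)| >= c |phi(0)|
   with c > 0 independent of n (Erdos), while the Riemann-Lebesgue lemma gives
   phi(2 pi alpha^n) -> 0; so nu = 0. *)

Set Implicit Arguments.
Unset Strict Implicit.
Unset Printing Implicit Defensive.
Import Order.TTheory GRing.Theory Num.Theory.
Import numFieldNormedType.Exports.
Import HBSimple.

Local Open Scope classical_set_scope.
Local Open Scope ring_scope.

(** * Powers of Pisot numbers *)

Section power_sums.
Context (A K : comNzRingType) (f : {rmorphism A -> K}).

(* The sum over z in s of z^n prod_(x != z) ('X - x); modulo the product p of
   the 'X - z it is 'X^n p', which is defined over A. *)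
Fixpoint weighted_deriv (n : nat) (s : seq K) : {poly K} :=
  if s is z :: s' then
    (z ^+ n)%:P * \prod_(x <- s') ('X - x%:P)
      + ('X - z%:P) * weighted_deriv n s'
  else 0.

Lemma weighted_deriv0 s :
  weighted_deriv 0 s = (\prod_(x <- s) ('X - x%:P))^`().
Proof.
elim: s => [|z s IH] /=; first by rewrite big_nil -polyC1 derivC.
by rewrite big_cons derivM derivXsubC expr0 polyC1 IH.
Qed.

(** In the summand of [z], split ['X] as [z + ('X - z)]: the first part raises the exponent of [z],
    the second completes the product. *)
Lemma weighted_derivS n s :
  'X * weighted_deriv n s =
  (\sum_(z <- s) z ^+ n)%:P * \prod_(x <- s) ('X - x%:P)
    + weighted_deriv n.+1 s.
Proof.
elim: s => [|z s IH] /=; first by rewrite !big_nil mulr0 mul0r addr0.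
rewrite mulrDr [X in _ + X]mulrCA IH !big_cons exprS !polyCD !polyCM; ring.
Qed.

Lemma size_weighted_deriv n s : (size (weighted_deriv n s) <= size s)%N.
Proof.
elim: s => [|z s IH] /=; first by rewrite size_poly0.
apply: leq_trans (size_polyD _ _) _; rewrite geq_max; apply/andP; split.
  rewrite mul_polyC; apply: leq_trans (size_scale_leq _ _) _.
  by rewrite size_prod_XsubC.
have [->|nz] := eqVneq (weighted_deriv n s) 0; first by rewrite mulr0 size_poly0.
by rewrite size_monicM ?monicXsubC// size_XsubC.
Qed.

(** Each product with one factor left out is monic of degree [(size s).-1], so the summand of [z]
    contributes [z ^+ n] to this coefficient. *)
Lemma coef_weighted_deriv n s :
  (weighted_deriv n s)`_(size s).-1 = \sum_(z <- s) z ^+ n.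
Proof.
elim: s => [|z s IH] /=; first by rewrite coef0 big_nil.
rewrite coefD coefCM big_cons mulrBl coefB coefXM coefCM.
rewrite [(weighted_deriv n s)`_(size s)]nth_default ?size_weighted_deriv//.
have /monicP := monic_prod_XsubC s xpredT id.
rewrite lead_coefE size_prod_XsubC /= => ->; rewrite mulr1 mulr0 subr0.
(* Multiplication by ['X] shifts the index by one, except for empty [s], where both sides are 0. *)
congr (_ + _); case: s IH => [|y s] /= IH; last exact: IH.
by rewrite big_nil.
Qed.

(** A division-free form of Newton's identities: every [weighted_deriv n s] lifts to a polynomial
    over [A], and the power sum is one of its coefficients. *)
Lemma integral_power_sum (q : {poly A}) (s : seq K) n :
  map_poly f q = \prod_(z <- s) ('X - z%:P) ->
  exists a : A, \sum_(z <- s) z ^+ n = f a.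
Proof.
move=> qE; suff [r rE] : exists r : {poly A}, map_poly f r = weighted_deriv n s.
  by exists r`_(size s).-1; rewrite -coef_weighted_deriv -rE coef_map.
elim: n => [|n [r rE]].
  by exists q^`(); rewrite weighted_deriv0 -deriv_map qE.
(* This is [weighted_derivS] solved for the next term; the coefficient of [r] lifts the power
   sum. *)
exists ('X * r - (r`_(size s).-1)%:P * q).
rewrite rmorphB !rmorphM /= map_polyX map_polyC /= rE qE weighted_derivS.
by rewrite -coef_map rE coef_weighted_deriv addrAC subrr add0r.
Qed.

End power_sums.

(** * Minimal polynomials and Galois conjugates *)

Section minimal_polynomial.
Context (R : realType).
Implicit Type a : R.

(** A nonzero rational polynomial of least size among those vanishing at [a], made monic, is
    irreducible, since [a] is a root of one of the factors in any factorization. *)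
Lemma exists_minimal_poly a : algebraic_integer a ->
  exists p : {poly rat}, is_minimal_poly p a.
Proof.
move=> [q monq rootq].
pose P n := `[< exists p : {poly rat},
  [/\ p != 0, root (map_poly ratr p) a & size p = n] >].
have exP : exists n, P n.
  exists (size (map_poly intr q : {poly rat})); apply/asboolP.
  exists (map_poly intr q); split => //.
    exact/monic_neq0/monic_map.
  rewrite -map_poly_comp; congr (is_true (root _ _)): rootq.
  by apply: eq_map_poly => z /=; rewrite ratr_int.
case: (ex_minnP exP) => m /asboolP[p [p0 rootp szp]] minm.
have {}minm (r : {poly rat}) : r != 0 -> root (map_poly ratr r) a ->
    (size p <= size r)%N.
  by move=> r0 rr; rewrite szp; apply: minm; apply/asboolP; exists r.
have lp0 : lead_coef p != 0 by rewrite lead_coef_eq0.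
have lpV0 : (lead_coef p)^-1 != 0 by rewrite invr_eq0.
exists ((lead_coef p)^-1 *: p); split.
- by rewrite monicE lead_coefZ mulVf.
- split=> [|r sr1].
    rewrite size_scale// ltn_neqAle eq_sym size_poly_gt0 p0 andbT.
    apply: contraL rootp => /size_poly1P[c c0 ->].
    by rewrite map_polyC /= rootC fmorph_eq0.
  rewrite dvdpZr// => rp.
  have /dvdpP[s ps] := rp.
  have /andP[s0 r0] : (s != 0) && (r != 0).
    by rewrite -negb_or -mulf_eq0 -ps.
  rewrite eqp_sym (eqp_ltrans (eqp_scale _ _))// eqp_sym -dvdp_size_eqp//.
  rewrite eqn_leq dvdp_leq//=.
  (* If [a] is a root of [s], minimality forces [r] to be constant, contrary to [sr1]; hence it is a
     root of [r], and [r] is as large as [p]. *)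
  move: rootp; rewrite {1}ps rmorphM rootM => /orP[/(minm _ s0)|/(minm _ r0)//].
  rewrite {1}ps size_mul// => h.
  move: sr1 r0; rewrite -size_poly_gt0; move: h; move: (size r) => [|[|k]]//=.
  by rewrite !addnS /= -ltn_subRL subnn.
- by rewrite linearZ/= rootZ// fmorph_eq0.
Qed.

(** Otherwise [p] and [q] are coprime; coprimality survives extension of the field and excludes a
    common root. *)
Lemma irreducible_root_dvdp a (p q : {poly rat}) :
  irreducible_poly p -> root (map_poly ratr p) a -> root (map_poly ratr q) a ->
  p %| q.
Proof.
move=> irrp rootp rootq.
have [cop|gp] := irredp_XsubCP irrp (dvdp_gcdl p q).
  have : coprimep (map_poly (ratr : rat -> R) p) (map_poly ratr q).
    by rewrite coprimep_map /coprimep size_poly_eq1.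
  by move/coprimep_root => /(_ _ rootp); rewrite (rootP rootq) eqxx.
by rewrite -(eqp_dvdl _ gp) dvdp_gcdr.
Qed.

(** Gauss's lemma: [p] is [c] times an integer factor [p1] of a monic integer polynomial. Hence the
    leading coefficient of [p1] is 1 or -1, and as [p] is monic, [c] equals that sign. *)
Lemma minimal_poly_int a (p : {poly rat}) :
  algebraic_integer a -> is_minimal_poly p a ->
  exists q : {poly int}, p = map_poly intr q.
Proof.
move=> [q monq rootq] [monp irrp rootp].
have /dvdpP_rat_int[p1 [c c0 pE] [r qE]] : p %| map_poly intr q.
  apply: (irreducible_root_dvdp irrp rootp).
  rewrite -map_poly_comp; congr (is_true (root _ _)): rootq.
  by apply: eq_map_poly => z /=; rewrite ratr_int.
have u1 : lead_coef p1 \is a GRing.unit.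
  apply/unitrPr; exists (lead_coef r).
  by rewrite -lead_coefM -qE; exact/eqP.
have cE : c * (lead_coef p1)%:~R = 1.
  have := monicP monp; rewrite pE lead_coefZ lead_coef_map_inj//.
  exact: (@intr_inj rat).
exists (lead_coef p1 *: p1).
rewrite linearZ /= {1}pE; congr (_ *: _).
have : lead_coef p1 ^+ 2 = 1.
  by have /orP[/eqP->|/eqP->] : (lead_coef p1 == 1) || (lead_coef p1 == -1).
move=> l2.
by rewrite -[LHS]mulr1 -[X in _ * X]/(1%:~R) -l2 expr2 intrM mulrA cE mul1r.
Qed.

Local Open Scope complex_scope.

Lemma map_ratr_complex (p : {poly rat}) :
  map_poly (ratr : rat -> R[i]) p =
  map_poly (real_complex R) (map_poly ratr p).
Proof.
rewrite -map_poly_comp; apply: eq_map_poly => x.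
exact/esym/(fmorph_eq_rat (real_complex R \o ratr)).
Qed.

(** In characteristic 0 the derivative is nonzero and smaller than [p], so [p] cannot divide it.
    Thus [a] occurs only once among the complex roots of [p]. *)
Lemma minimal_poly_simple_root a (p : {poly rat}) : is_minimal_poly p a ->
  ~~ root (map_poly (ratr : rat -> R) p^`()) a.
Proof.
move=> [monp irrp rootp]; apply/negP => rootp'.
have sp : (1 < size p)%N := irrp.1.
have p'0 : p^`() != 0.
  by rewrite -size_poly_gt0 size_deriv; case: (size p) sp => [|[]].
have := irreducible_root_dvdp irrp rootp rootp'.
move/(dvdp_leq p'0); rewrite leqNgt lt_size_deriv// -size_poly_gt0.
exact: ltnW.
Qed.

Lemma minimal_poly_conjugates a : pisot a ->
  exists s : seq R[i], (forall z, z \in s -> `|z| < 1) /\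
    exists q : {poly int},
      map_poly intr q = \prod_(z <- a%:C :: s) ('X - z%:P).
Proof.
move=> [a1 alga conja].
have [p minp] := exists_minimal_poly alga.
have [q pq] := minimal_poly_int alga minp.
have [monp irrp rootp] := minp.
have [r prodr] := closed_field_poly_normal (map_poly (ratr : rat -> R[i]) p).
have lead1 : lead_coef (map_poly (ratr : rat -> R[i]) p) = 1.
  by rewrite lead_coef_map (monicP monp) rmorph1.
rewrite lead1 scale1r in prodr.
have ar : a%:C \in r.
  rewrite -root_prod_XsubC -prodr map_ratr_complex.
  by rewrite /root horner_map (rootP rootp).
have prodr' : map_poly ratr p = \prod_(z <- a%:C :: rem a%:C r) ('X - z%:P).
  by rewrite prodr (perm_big _ (perm_to_rem ar)).
exists (rem a%:C r); split => [z zr|].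
  apply: conja.
    exists p => //; rewrite prodr root_prod_XsubC; exact: mem_rem zr.
  (* A second occurrence of [a] in [r] would make it a root of the derivative. *)
  apply: contraNneq (minimal_poly_simple_root minp) => za.
  rewrite -(fmorph_root (real_complex R)) -map_ratr_complex -deriv_map prodr'.
  rewrite big_cons derivM derivXsubC mul1r rootE hornerD hornerM hornerXsubC.
  by rewrite subrr mul0r addr0 -rootE root_prod_XsubC; rewrite za in zr.
exists q; rewrite -prodr' pq -map_poly_comp.
by apply: eq_map_poly => x /=; rewrite ratr_int.
Qed.

(** The integer is the [n]-th power sum of all conjugates. The others lie in a disc of radius
    [t < 1], so they contribute at most their number times [t ^+ n]. *)
Lemma pisot_powers_near_int a : pisot a ->
  exists C t : R, [/\ 0 <= C, 0 <= t, t < 1 &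
    forall n, exists k : int, `|a ^+ n - k%:~R| <= C * t ^+ n].
Proof.
move=> pa; have [s [s1 [q qE]]] := minimal_poly_conjugates pa.
have [t [t0 t1 st]] : exists t : R, [/\ 0 <= t, t < 1 &
    forall z, z \in s -> `|z| <= t%:C].
  elim: s s1 {qE} => [|z s IH] s1; first by exists 0; rewrite lexx ltr01.
  have [|t [t0 t1 st]] := IH; first by move=> y ys; rewrite s1// inE ys orbT.
  exists (Num.max t (complex.Re `|z|)); split.
  - by rewrite le_max t0.
  - by rewrite gt_max t1 andTb -ltcR RRe_real ?normr_real// s1// inE eqxx.
  - move=> y; rewrite inE => /orP[/eqP->|ys].
      rewrite -[leLHS]RRe_real ?normr_real// lecR le_max lexx orbT//.
    by rewrite (le_trans (st _ ys))// lecR le_max lexx.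
exists (size s)%:R, t; split => // n.
have [k kE] := integral_power_sum n qE.
exists k; have eqk : a ^+ n - k%:~R = complex.Re (- \sum_(z <- s) z ^+ n).
  suff <- : (a ^+ n - k%:~R)%:C = - \sum_(z <- s) z ^+ n by [].
  rewrite rmorphB rmorphXn /= rmorph_int -[_%:~R]kE big_cons.
  by rewrite opprD addrA subrr add0r.
rewrite -lecR eqk; apply: le_trans (normc_ge_Re _) _; rewrite normrN.
apply: le_trans (ler_norm_sum _ _ _) _.
rewrite rmorphM rmorphXn /= rmorph_nat.
elim: s st {s1 qE kE eqk} => [|z s IH] st /=; first by rewrite big_nil mul0r.
rewrite big_cons -natr1 mulrDl mul1r addrC lerD//.
  by apply: IH => y ys; rewrite st// inE ys orbT.
by rewrite normrX lerXn2r ?nnegrE ?normr_ge0 ?ler0c// st// inE eqxx.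
Qed.

End minimal_polynomial.

(** * The Riemann-Lebesgue lemma *)

Lemma cvg0_approx (R : realType) (u : R^nat) :
  (forall e, 0 < e ->
    exists v : R^nat, v @ \oo --> 0 /\ forall n, `|u n - v n| <= e) ->
  u @ \oo --> 0.
Proof.
move=> uv; apply/cvgrPdist_le => e e0.
have [|v [v0 uve]] := uv (e / 2); first by rewrite divr_gt0.
have /cvgrPdist_le/(_ (e / 2)) := v0; rewrite divr_gt0// => /(_ isT).
apply: filterS => n vn.
rewrite -opprB subr0 normrN -(subrK (v n) (u n)).
rewrite (le_trans (ler_normD _ _))// [leRHS]splitr lerD//.
by move: vn; rewrite sub0r normrN.
Qed.

Section bounded_by_one.
Context d (T : measurableType d) (R : realType).
Variables (m : {measure set T -> \bar R}) (f : T -> R).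
Hypothesis mf : measurable_fun setT f.
Hypothesis f1 : forall x, `|f x| <= 1.

Lemma integrable_le1 D : measurable D -> (m D < +oo)%E ->
  m.-integrable D (EFin \o f).
Proof.
move=> mD Dfin; apply: measurable_bounded_integrable => //.
  exact: measurable_funTS.
exists 1; split; first exact: num_real.
by move=> M M1 x _ /=; rewrite (le_trans (f1 x))// ltW.
Qed.

Lemma normr_Rintegral_le D : measurable D -> (m D < +oo)%E ->
  `|\int[m]_(x in D) f x| <= fine (m D).
Proof.
move=> mD Dfin; have fi := integrable_le1 mD Dfin.
apply: le_trans (le_normr_Rintegral mD fi) _.
rewrite -[leRHS]mul1r -Rintegral_cst//; apply: le_Rintegral => //.
- exact: integrable_norm.
- apply: measurable_bounded_integrable => //.
  exists 1; split; first exact: num_real.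
  by move=> M M1 x _ /=; rewrite normr1 ltW.
Qed.

Lemma Rintegral_setD A B : measurable A -> measurable B -> B `<=` A ->
  (m A < +oo)%E ->
  \int[m]_(x in A `\` B) f x =
  \int[m]_(x in A) f x - \int[m]_(x in B) f x.
Proof.
move=> mA mB BA Afin.
have {2}-> : A = (A `\` B) `|` B by rewrite setUC setDUK.
rewrite Rintegral_setU ?addrK//.
- exact: measurableD.
- by rewrite setUC setDUK//; exact: integrable_le1.
- by apply/disj_setPS => x [[_]].
Qed.

End bounded_by_one.

(** * From oscillation on test sets to oscillation against integrable functions *)

Section oscillating.
Context d (T : measurableType d) (R : realType).
Variables (m : {measure set T -> \bar R}) (e : nat -> T -> R).
Hypothesis me : forall n, measurable_fun setT (e n).
Hypothesis e1 : forall n x, `|e n x| <= 1.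
Variable D : set T.
Hypothesis mD : measurable D.
Hypothesis Dfin : (m D < +oo)%E.

Lemma measure_setI_lty A : measurable A -> (m (D `&` A) < +oo)%E.
Proof.
move=> mA; apply: le_lt_trans Dfin.
by apply: le_measure; rewrite ?inE//; exact: measurableI.
Qed.

(** Prepares Dynkin's pi-lambda argument. For increasing unions, replacing the union by [F k]
    changes the integrals by at most the measure of the difference, uniformly in [n]. *)
Lemma oscillating_lambda_system :
  (fun n => \int[m]_(x in D) e n x) @ \oo --> 0 ->
  lambda_system setT [set A | measurable A /\
    (fun n => \int[m]_(x in D `&` A) e n x) @ \oo --> 0].
Proof.
move=> DT; split => //.
- by split => //; rewrite setIT.
- move=> A B BA [mA A0] [mB B0]; split; first exact: measurableD.
  rewrite setIDA.
  have -> : D `&` A `\` B = (D `&` A) `\` (D `&` B).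
    by apply/seteqP; split => x /= [[Dx Ax]] Bx; split => //; [case|];
       move=> // Bx'; apply: Bx.
  have -> : (fun n => \int[m]_(x in (D `&` A) `\` (D `&` B)) e n x) =
      (fun n => \int[m]_(x in D `&` A) e n x - \int[m]_(x in D `&` B) e n x).
    apply/funext => n; apply: Rintegral_setD; rewrite ?measure_setI_lty//.
    + exact: measurableI.
    + exact: measurableI.
    + exact: setIS.
  by have := cvgB A0 B0; rewrite subrr; exact.
- move=> F ndF FG; have mF k : measurable (F k) by case: (FG k).
  have mUF : measurable (\bigcup_k F k) by exact: bigcup_measurable.
  split => //; apply: cvg0_approx => r r0.
  have : m (D `&` F k) @[k --> \oo] --> m (\bigcup_k (D `&` F k)).
    apply: nondecreasing_cvg_mu.
    - by move=> k; exact: measurableI.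
    - by apply: bigcup_measurable => k _; exact: measurableI.
    - by move=> i j /ndF/subsetPset Fij; apply/subsetPset; exact: setIS.
  rewrite -setI_bigcupr -[X in _ --> X](@fineK _); last first.
    by rewrite ge0_fin_numE// measure_setI_lty.
  move=> /fine_cvgP[_ /cvgrPdist_le /(_ _ r0)[k _ /(_ k)/=]].
  move=> /(_ (leqnn _)) kr.
  exists (fun n => \int[m]_(x in D `&` F k) e n x); split; first by case: (FG k).
  move=> n; have FUF : D `&` F k `<=` D `&` \bigcup_k F k.
    by apply: setIS; exact: bigcup_sup.
  rewrite -Rintegral_setD ?measure_setI_lty//; [|exact: measurableI..].
  have mDF : measurable (D `&` F k) by exact: measurableI.
  have mDU : measurable (D `&` \bigcup_k F k) by exact: measurableI.
  apply: le_trans (normr_Rintegral_le _ _ _ _) _ => //.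
  + exact: measurableD.
  + apply: le_lt_trans (measure_setI_lty mUF).
    by apply: le_measure; rewrite ?inE//; exact: measurableD.
  rewrite measureD// ?measure_setI_lty// (setIidr FUF) fineB//.
  + exact: le_trans (ler_norm _) kr.
  + by rewrite ge0_fin_numE// measure_setI_lty.
  + by rewrite ge0_fin_numE// measure_setI_lty.
Qed.

Hypothesis eD : forall A, measurable A ->
  (fun n => \int[m]_(x in D `&` A) e n x) @ \oo --> 0.

(** The values [r] index their own level sets [A r], as in the canonical form of a simple function.
    Integrability is carried through the induction because additivity of the integral needs it. *)
Lemma oscillating_step (s : seq R) (A : R -> set T) :
  (forall r, measurable (A r)) ->
  (forall n, m.-integrable D
    (EFin \o (fun x => (\sum_(r <- s) r * \1_(A r) x) * e n x))) /\
  (fun n => \int[m]_(x in D) ((\sum_(r <- s) r * \1_(A r) x) * e n x))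
    @ \oo --> 0.
Proof.
move=> mA; elim: s => [|r s [ints IH]].
  split=> [n|].
    apply: eq_integrable (integrable0 m D) => // x _ /=.
    by rewrite big_nil mul0r.
  under eq_fun do under eq_Rintegral do rewrite big_nil mul0r.
  by under eq_fun do rewrite Rintegral_cst// mul0r; exact: cvg_cst.
have splitE n x : (\sum_(q <- r :: s) q * \1_(A q) x) * e n x =
    r * (e n \_ (A r)) x + (\sum_(q <- s) q * \1_(A q) x) * e n x.
  rewrite big_cons mulrDl patchE indicE; case: ifPn => _.
    by rewrite mulr1.
  by rewrite !mulr0 mul0r.
have intr1 n : m.-integrable D (EFin \o (e n \_ (A r))).
  rewrite -restrict_EFin; apply/integrable_restrict => //.
  by apply: integrable_le1; rewrite ?measure_setI_lty//; exact: measurableI.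
have intr n : m.-integrable D (EFin \o (fun x => r * (e n \_ (A r)) x)).
  by apply: eq_integrable (integrableZl mD r (intr1 n)) => // x _.
split=> [n|].
  apply: eq_integrable (integrableD _ (intr n) (ints n)) => // x _ /=.
  by rewrite splitE EFinD.
under eq_fun do under eq_Rintegral do rewrite splitE.
under eq_fun do rewrite RintegralD// RintegralZl// -Rintegral_mkcondr.
have := cvgD (cvgM (cvg_cst r) (eD (mA r))) IH.
by rewrite mulr0 addr0; exact.
Qed.

(** Simple functions are dense in L^1, and [|e n| <= 1] makes the approximation error uniform in
    [n]. *)
Lemma oscillating_integrable (f : T -> R) :
  m.-integrable D (EFin \o f) ->
  (fun n => \int[m]_(x in D) (f x * e n x)) @ \oo --> 0.
Proof.
move=> intf; have [g [intg _ g0]] := approximation_sfun_integrable mD intf.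
apply: cvg0_approx => r r0.
have intfg k : m.-integrable D (EFin \o (f \- g k)).
  exact: eq_integrable (integrableB _ intf (intg k)).
have [k gk] : exists k, \int[m]_(x in D) `|f x - g k x| <= r.
  move: g0 => /fine_cvgP[_ /cvgrPdist_le /(_ _ r0)[k _ /(_ k (leqnn _))]].
  rewrite sub0r normrN /= => gr; exists k; apply: le_trans gr.
  exact: ler_norm.
have gE x : g k x = \sum_(q <- enum_fset (fset_set (range (g k))))
    q * \1_(g k @^-1` [set q]) x.
  by rewrite {1}fimfunE fsbig_finite.
have mpre q : measurable (g k @^-1` [set q]) by exact: measurable_funPTI.
have [intge ge0] := oscillating_step (enum_fset (fset_set (range (g k)))) mpre.
have eqge n : (fun x => (\sum_(q <- enum_fset (fset_set (range (g k))))
    q * \1_(g k @^-1` [set q]) x) * e n x) = (fun x => g k x * e n x).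
  by apply/funext => x; rewrite -gE.
exists (fun n => \int[m]_(x in D) (g k x * e n x)); split.
  by move: ge0; under eq_fun do rewrite eqge.
move=> n; move: (intge n); rewrite eqge => {}intge.
have intM (h : T -> R) : m.-integrable D (EFin \o h) ->
    m.-integrable D (EFin \o (fun x => h x * e n x)).
  move=> inth; apply: (le_integrable mD _ _ inth) => //.
    apply/measurable_EFinP/measurable_funM; last exact: measurable_funTS.
    exact/measurable_EFinP/(measurable_int _ inth).
  by move=> x _ /=; rewrite lee_fin normrM ler_piMr.
rewrite -RintegralB//; [|exact: intM].
under eq_Rintegral do rewrite -mulrBl.
apply: le_trans (le_normr_Rintegral _ _) _ => //; first exact: (intM (f \- g k)).
apply: le_trans gk; apply: le_Rintegral => //.
- by apply: integrable_norm; exact: (intM (f \- g k)).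
- exact: (integrable_norm (intfg k)).
- by move=> x _; rewrite normrM ler_piMr.
Qed.

End oscillating.

Section oscillating_real.
Context (R : realType).
Local Notation leb := (@lebesgue_measure R).
Variable e : nat -> measurableTypeR R -> R.
Hypothesis me : forall n, measurable_fun setT (e n).
Hypothesis e1 : forall n x, `|e n x| <= 1.
Hypothesis e_itv : forall a b : R, a < b ->
  (fun n => \int[leb]_(x in `]a, b]) e n x) @ \oo --> 0.

Lemma lebesgue_itvoc_lty (a b : R) : (leb `]a, b]%classic < +oo)%E.
Proof. by rewrite lebesgue_measure_itv /=; case: ifPn => //; rewrite ltry. Qed.

(** Half-open intervals form a pi-system generating the Borel sets, so the lambda-system above
    contains every Borel set. *)
Lemma oscillating_measurable (a b : R) (A : set (measurableTypeR R)) :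
  measurable A ->
  (fun n => \int[leb]_(x in `]a, b] `&` A) e n x) @ \oo --> 0.
Proof.
have e_ocitv X : ocitv X -> (fun n => \int[leb]_(x in X) e n x) @ \oo --> 0.
  move=> /ocitvP[->|[[c d] /= cd ->]]; last exact: e_itv.
  by under eq_fun do rewrite Rintegral_set0; exact: cvg_cst.
have mab : measurable (`]a, b]%classic : set (measurableTypeR R)).
  exact: measurable_itv.
have lsys := oscillating_lambda_system me e1 mab (lebesgue_itvoc_lty a b)
  (e_ocitv _ (is_ocitv a b)).
move=> mA; have [] // := lambda_system_subset (@ocitvI R) lsys _ _ mA.
by move=> X oX; split; [exact: sub_sigma_algebra|
  apply/e_ocitv/ocitvI => //; exact: is_ocitv].
Qed.

(** Up to a small [nu]-mass one may restrict to a bounded interval [D k]; there [nu] has an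
    integrable density with respect to Lebesgue measure. *)
Lemma oscillating_null_dominates
    (nu : {finite_measure set (measurableTypeR R) -> \bar R}) :
  nu `<< leb -> (fun n => \int[nu]_x e n x) @ \oo --> 0.
Proof.
move=> nuleb; apply: cvg0_approx => r r0.
pose D (k : nat) : set (measurableTypeR R) := `]- k%:R, k%:R]%classic.
have mD k : measurable (D k) by exact: measurable_itv.
have nufin A : measurable A -> (nu A < +oo)%E.
  by move=> mA; rewrite -ge0_fin_numE// fin_num_measure.
have [k nuDk] : exists k, fine (nu (setT `\` D k)) <= r.
  have : nu (D k) @[k --> \oo] --> nu (\bigcup_k D k).
    apply: nondecreasing_cvg_mu => //; first exact: bigcup_measurable.
    move=> i j ij; apply/subsetPset => x; rewrite /D /= !in_itv /= => /andP[ix xi].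
    by rewrite (le_lt_trans _ ix) ?lerN2 ?ler_nat// (le_trans xi)// ler_nat.
  have -> : \bigcup_k D k = setT.
    apply/seteqP; split => // x _; exists (Num.bound `|x|) => //.
    have := archi_boundP (normr_ge0 x); rewrite ltr_norml => /andP[xl xr].
    by rewrite /D /= in_itv /= xl ltW.
  rewrite -[X in _ --> X](@fineK _) ?fin_num_measure//.
  move=> /fine_cvgP[_ /cvgrPdist_le /(_ _ r0)[k _ /(_ k (leqnn _))/=]] kr.
  exists k; rewrite measureD// ?nufin// setTI fineB ?fin_num_measure//.
  exact: le_trans (ler_norm _) kr.
(* The density is finite everywhere, so [fine] does not alter it. *)
pose f x := fine (Radon_Nikodym (charge_of_finite_measure nu) leb x).
exists (fun n => \int[leb]_(x in D k) (f x * e n x)); split.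
  apply: oscillating_integrable => //.
  - exact: lebesgue_itvoc_lty.
  - by move=> A; exact: oscillating_measurable.
  - have := Radon_Nikodym_integrable (nu := charge_of_finite_measure nu) nuleb.
    move/(integrableS measurableT (mD k) (@subsetT _ _)).
    apply: eq_integrable => // x _.
    by rewrite /f /= fineK// Radon_Nikodym_fin_num.
move=> n; have -> : \int[leb]_(x in D k) (f x * e n x) = \int[nu]_(x in D k) e n x.
  rewrite /Rintegral -(Radon_Nikodym_change_of_variables nuleb)//; last first.
    by apply: integrable_le1; rewrite ?nufin.
  congr fine; apply: eq_integral => x _.
  by rewrite muleC EFinM /f fineK// Radon_Nikodym_fin_num.
rewrite -Rintegral_setD//; last exact: nufin.
apply: le_trans nuDk; apply: normr_Rintegral_le => //; first exact: measurableD.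
by apply: nufin; exact: measurableD.
Qed.

End oscillating_real.

(** * Cosines of growing frequency *)

Section riemann_lebesgue.
Context (R : realType).
Local Notation leb := (@lebesgue_measure R).

Lemma is_derive_sin_affine (xi phi x : R) : xi != 0 ->
  is_derive x 1 (fun y : R => xi^-1 * sin (xi * y + phi)) (cos (xi * x + phi)).
Proof.
move=> xi0.
have d1 : is_derive x 1 (fun y : R => xi * y + phi) xi.
  by apply: is_derive_eq; rewrite /GRing.scale /=; ring.
have d2 := @is_derive1_comp R sin (fun y : R => xi * y + phi) x _ _ (is_derive_sin _) d1.
have d3 := is_deriveZ xi^-1 d2.
apply: (is_derive_eq d3).
by rewrite /GRing.scale /= mulrCA mulVf// mulr1.
Qed.

Lemma continuous_cos_affine (xi phi : R) :
  continuous (fun y : R => cos (xi * y + phi)).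
Proof.
move=> x; apply: (@continuous_comp _ _ _ (fun y : R => xi * y + phi) cos).
  by apply: cvgD; [apply: cvgM; [exact: cvg_cst|exact: cvg_id]|exact: cvg_cst].
exact: continuous_cos.
Qed.

Lemma measurable_cos_affine (xi phi : R) (D : set (measurableTypeR R)) :
  measurable_fun D (fun y : measurableTypeR R => cos (xi * y + phi)).
Proof.
apply: measurable_funTS; apply: continuous_measurable_fun.
exact: continuous_cos_affine.
Qed.

Lemma normr_integral_cos_le (xi phi a b : R) : 0 < xi -> a < b ->
  `|\int[leb]_(x in `]a, b]) cos (xi * x + phi)| <= 2 / xi.
Proof.
move=> xi0 ab; rewrite Rintegral_itv_obnd_cbnd; last first.
  apply: integrable_le1.
  - exact: measurable_cos_affine.
  - by move=> x; exact: cos_max.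
  - exact: measurable_itv.
  - exact: lebesgue_itvoc_lty.
have xin0 : xi != 0 by rewrite gt_eqF.
have F' x := is_derive_sin_affine phi x xin0.
have cF : continuous (fun y : R => xi^-1 * sin (xi * y + phi)).
  by move=> x; apply/differentiable_continuous/derivable1_diffP; exact: ex_derive.
rewrite /Rintegral (@continuous_FTC2 _ _ (fun y : R => xi^-1 * sin (xi * y + phi)))//.
- rewrite /= -mulrBr normrM gtr0_norm ?invr_gt0// mulrC ler_pM2r ?invr_gt0//.
  by rewrite (le_trans (ler_normB _ _))// -(natr1 1) lerD// sin_max.
- exact/continuous_subspaceT/continuous_cos_affine.
- split.
  + by move=> x _; exact: ex_derive.
  + apply: cvg_at_right_filter; exact: cF.
  + apply: cvg_at_left_filter; exact: cF.
- by move=> x _; rewrite derive1E derive_val.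
Qed.

(** The phase treats both parts of the Fourier transform at once: [0] gives the cosine and
    [- (pi / 2)] the sine. *)
Lemma Riemann_Lebesgue (nu : {finite_measure set (measurableTypeR R) -> \bar R})
    (xi : R^nat) (phi : R) : nu `<< leb -> xi @ \oo --> +oo ->
  (fun n => \int[nu]_x cos (xi n * x + phi)) @ \oo --> 0.
Proof.
move=> nuleb xioo.
apply: (@oscillating_null_dominates R (fun n x => cos (xi n * x + phi))) => //.
- by move=> n; exact: measurable_cos_affine.
- by move=> n x; exact: cos_max.
move=> a b ab; apply/cvgrPdist_le => r r0.
have /cvgryPgt /(_ (Num.max 0 (2 / r))) := xioo.
apply: filterS => n; rewrite gt_max => /andP[xi0 xir].
rewrite sub0r normrN (le_trans (normr_integral_cos_le phi xi0 ab))//.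
by rewrite ler_pdivrMr// mulrC -ler_pdivrMr// ltW.
Qed.

(** By the mean value theorem. A linear bound is enough, since it is later summed over geometrically
    small [t]. *)
Lemma cos_lipschitz0 (t : R) : 1 - cos t <= `|t|.
Proof.
wlog t0 : t / 0 <= t.
  move=> H; have [/H//|/ltW t0] := leP 0 t.
  by rewrite -cosN -normrN H// oppr_ge0.
have [c _] := @MVT_segment R cos (fun x => - sin x) 0 t t0
   (fun x _ => is_derive_cos x) (continuous_subspaceT (@continuous_cos R)).
rewrite cos0 subr0 => ct; rewrite -opprB ct mulNr opprK.
rewrite (le_trans (ler_norm _))// normrM ler_piMl// sin_max//.
Qed.

End riemann_lebesgue.

(** * The energy of a self-similar measure along Pisot frequencies *)

Lemma cosDint (R : realType) (t : R) (k : int) : cos (t + 2 * pi * k%:~R) = cos t.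
Proof.
have H n (u : R) : cos (u + 2 * pi * n%:R) = cos u.
  by rewrite mulr_natl mulr_natr (periodicn (@cosD2pi R)).
case: k => n; first exact: H.
by rewrite NegzE rmorphN /= mulrN -(H n.+1) subrK.
Qed.

Section pisot_frequencies.
Context (R : realType) (a : R).
Hypothesis pa : pisot a.

(** The frequencies are [2 * pi * a ^ (j - m)], split at [j = m]. One bound for all [m] and [n]
    allows orbits that start arbitrarily close to frequency 0. *)
Lemma pisot_cos_summable : exists K : R, forall m n : nat,
  \sum_(j < m + n) (1 - cos (2 * pi * a ^- m * a ^+ j)) <= K.
Proof.
have a1 : 1 < a by case: pa.
have a0 : 0 < a by exact: lt_trans a1.
have pi0 : 0 < 2 * pi :> R by rewrite mulr_gt0// pi_gt0.
have [C [t [C0 t0 t1 near_int]]] := pisot_powers_near_int pa.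
have geo (x : R) n : 0 <= x -> x < 1 -> \sum_(j < n) x ^+ j <= (1 - x)^-1.
  move=> x0 x1; rewrite -[leRHS]mul1r ler_pdivlMr ?subr_gt0// mulrC.
  by rewrite -opprB mulNr -subrX1 opprB gerBl exprn_ge0.
(* The first term bounds the indices below [m], by a geometric series in [a^-1]; the second bounds
   the rest, by one in [t]. *)
exists (2 * pi * (1 - a^-1)^-1 + 2 * pi * (C * (1 - t)^-1)) => m n.
have aV0 : 0 < a^-1 by rewrite invr_gt0.
have aV1 : a^-1 < 1 by rewrite invf_lt1.
rewrite big_split_ord /= lerD//.
  rewrite (reindex_inj rev_ord_inj) /=.
  apply: le_trans (ler_wpM2l (ltW pi0) (geo _ m (ltW aV0) aV1)).
  rewrite mulr_sumr; apply: ler_sum => i _.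
  apply: le_trans (cos_lipschitz0 _) _.
  have -> : 2 * pi * a ^- m * a ^+ (m - i.+1) = 2 * pi * a^-1 ^+ i.+1.
    rewrite -mulrA; congr (_ * _).
    rewrite -{1}(subnK (ltn_ord i)) exprD invfM mulrAC mulVf ?mul1r ?exprVn//.
    by rewrite expf_neq0// gt_eqF.
  rewrite (gtr0_norm (mulr_gt0 pi0 (exprn_gt0 _ aV0))) ler_pM2l// exprS ler_piMl ?ltW//.
  exact: exprn_gt0.
apply: le_trans (ler_wpM2l (ltW pi0) (ler_wpM2l C0 (geo _ n t0 t1))).
rewrite !mulr_sumr; apply: ler_sum => i _.
have [k ak] := near_int i.
have -> : 2 * pi * a ^- m * a ^+ (m + i) = 2 * pi * (a ^+ i - k%:~R) + 2 * pi * k%:~R.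
  rewrite exprD -!mulrA mulKf ?expf_neq0 ?gt_eqF//; ring.
rewrite cosDint; apply: le_trans (cos_lipschitz0 _) _.
by rewrite normrM gtr0_norm// ler_pM2l.
Qed.

End pisot_frequencies.

(** By [1 + x <= expR x] it suffices that [(1 + 9 * u) * (1 - u) >= 1], that is
    [u * (8 - 9 * u) >= 0]. The range covers [u = 4 / 9 * (1 - cos xi)]. *)
Lemma expRN_le_1B (R : realType) (u : R) : 0 <= u -> u <= 8 / 9 ->
  expR (- (9 * u)) <= 1 - u.
Proof.
move=> u0 u1; rewrite expRN -[leRHS]invrK lef_pV2 ?posrE ?invr_gt0 ?expR_gt0//.
  2: by lra.
apply: le_trans (expR_ge1Dx _).
rewrite -[leLHS]mul1r ler_pdivrMr; last by lra.
by nra.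
Qed.

(** * The self-similarity equation and its Fourier transform *)

Section self_similar_def.
Context (R : realType).

Definition digit_contraction (a b : R) (x : measurableTypeR R) : measurableTypeR R :=
  a^-1 * (x + b).

(* The equation m = 2/3 (c_0)_* m + 1/3 (c_1)_* m for the contractions c_b, with
   denominators cleared. *)
Definition self_similar (a : R) (m : set (measurableTypeR R) -> \bar R) :=
  forall A, measurable A ->
  (m A + (m A + m A) = m (digit_contraction a 0 @^-1` A) +
    (m (digit_contraction a 0 @^-1` A) + m (digit_contraction a 1 @^-1` A)))%E.

Lemma measurable_digit_contraction (a b : R) : measurable_fun setT (digit_contraction a b).
Proof.
apply: continuous_measurable_fun => x.
apply: cvgM; first exact: cvg_cst.
by apply: cvgD; [exact: cvg_id|exact: cvg_cst].
Qed.

End self_similar_def.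

Section self_similar.
Context (R : realType) (a : R).
Context (m : {finite_measure set (measurableTypeR R) -> \bar R}).
Let tau := digit_contraction a.
Hypothesis ssm : self_similar a m.

Let p (b : R) : {measure set (measurableTypeR R) -> \bar R} :=
  measure_function_pushforward__canonical__measure_function_Measure
    m (measurable_digit_contraction a b).

(** Both sides of [self_similar] are sums of three finite measures; integrate [f] against them and
    change variables in the pushforwards. *)
Lemma Rintegral_self_similar (f : measurableTypeR R -> R) :
  measurable_fun setT f -> (forall x, `|f x| <= 1) ->
  3 * \int[m]_x f x = 2 * \int[m]_x f (tau 0%R x) + \int[m]_x f (tau 1%R x).
Proof.
move=> mf f1.
have mT : (m setT < +oo)%E by rewrite -ge0_fin_numE// fin_num_measure.
have mEf : measurable_fun setT (EFin \o f) by exact/measurable_EFinP.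
have im : m.-integrable setT (EFin \o f) by exact: integrable_le1.
have ip b : (p b).-integrable setT (EFin \o f) by exact: integrable_le1.
have imt b : m.-integrable setT (EFin \o (f \o tau b)).
  apply: integrable_le1 => //; last by move=> x; exact: f1.
  exact: measurableT_comp (measurable_digit_contraction a b).
have pE b : (\int[p b]_x (f x)%:E = \int[m]_x (f (tau b x))%:E)%E.
  exact: (integral_pushforward (measurable_digit_contraction a b) mEf (imt b)).
have fadd (m1 m2 : {measure set (measurableTypeR R) -> \bar R}) :
    (m1 setT < +oo)%E -> (m2 setT < +oo)%E ->
    (\int[measure_add m1 m2]_x (f x)%:E =
     \int[m1]_x (f x)%:E + \int[m2]_x (f x)%:E)%E.
  move=> h1 h2; exact: (integral_measure_add measurableT
    (integrable_le1 mf f1 measurableT h1) (integrable_le1 mf f1 measurableT h2)).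
have addfin (m1 m2 : {measure set (measurableTypeR R) -> \bar R}) :
    (m1 setT < +oo)%E -> (m2 setT < +oo)%E -> (measure_add m1 m2 setT < +oo)%E.
  by move=> h1 h2; rewrite measure_addE lte_add_pinfty.
have H : (\int[m]_x (f x)%:E + (\int[m]_x (f x)%:E + \int[m]_x (f x)%:E) =
    \int[m]_x (f (tau 0%R x))%:E +
    (\int[m]_x (f (tau 0%R x))%:E + \int[m]_x (f (tau 1%R x))%:E))%E.
  rewrite -!pE -!fadd ?addfin//; apply: eq_measure_integral => A mA _.
  have addE3 (m1 m2 m3 : {measure set (measurableTypeR R) -> \bar R}) :
      (measure_add m1 (measure_add m2 m3) A = m1 A + (m2 A + m3 A))%E.
    by rewrite measure_addE; congr (_ + _)%E; exact: measure_addE.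
  exact: etrans (addE3 m m m) (etrans (ssm mA) (esym (addE3 (p 0) (p 0) (p 1)))).
have fineE (x y z : \bar R) : x \is a fin_num -> y \is a fin_num ->
    z \is a fin_num -> (x + (x + x) = y + (y + z))%E ->
    3 * fine x = 2 * fine y + fine z.
  by case: x y z => [x||] [y||] [z||]//= _ _ _ [xyz]; lra.
by apply: fineE H; apply: integrable_fin_num => //; exact: imt.
Qed.

Let c xi := \int[m]_x cos (xi * x).
Let s xi := \int[m]_x sin (xi * x).

Let m_lty : (m setT < +oo)%E.
Proof. by rewrite -ge0_fin_numE// fin_num_measure. Qed.

Let integrable_cos xi : m.-integrable setT (fun x => (cos (xi * x))%:E).
Proof.
apply: integrable_le1 => //; last by move=> x; exact: cos_max.
by have := measurable_cos_affine (D := setT) xi 0; under eq_fun do rewrite addr0.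
Qed.

Let integrable_sin xi : m.-integrable setT (fun x => (sin (xi * x))%:E).
Proof.
apply: integrable_le1 => //; last by move=> x; exact: sin_max.
have := measurable_cos_affine (D := setT) xi (- (pi / 2)).
by under eq_fun do rewrite cosBpihalf.
Qed.

Lemma Rintegral_cos_phase xi phi :
  \int[m]_x cos (xi * x + phi) = cos phi * c xi - sin phi * s xi.
Proof.
under eq_Rintegral do rewrite cosD [_ * cos phi]mulrC [_ * sin phi]mulrC.
have intZ k (h : measurableTypeR R -> R) : m.-integrable setT (EFin \o h) ->
    m.-integrable setT (EFin \o (fun x => k * h x)).
  move=> ih; exact: eq_integrable (integrableZl measurableT k ih).
rewrite RintegralB//; [|exact/intZ/integrable_cos|exact/intZ/integrable_sin].
by rewrite !RintegralZl//; [exact: integrable_sin|exact: integrable_cos].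
Qed.

(* The squared modulus of the Fourier transform of m at xi. *)
Definition energy xi := c xi ^+ 2 + s xi ^+ 2.

Hypothesis a_gt1 : 1 < a.

(** At [a * xi] the Fourier transform is [(2 + exp (i xi)) / 3] times its value at [xi], and the
    squared modulus of this factor is [(5 + 4 * cos xi) / 9]. *)
Lemma energy_scale xi :
  energy (a * xi) = (1 - 4 / 9 * (1 - cos xi)) * energy xi.
Proof.
have a0 : a != 0 by rewrite gt_eqF// (lt_trans _ a_gt1).
(* The digit 1 shifts the phase by [xi]; the values [0] and [- (pi / 2)] of [phi] then give [c] and
   [s]. *)
have step phi : 3 * \int[m]_x cos (a * xi * x + phi) =
    2 * \int[m]_x cos (xi * x + phi) + \int[m]_x cos (xi * x + (xi + phi)).
  rewrite Rintegral_self_similar.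
  - congr (2 * _ + _); apply: eq_Rintegral => x _; congr cos.
      by rewrite /tau /digit_contraction addr0 mulrACA divff// mul1r.
    by rewrite /tau /digit_contraction mulrACA divff// mul1r; ring.
  - exact: measurable_cos_affine.
  - by move=> x; exact: cos_max.
have cE x : \int[m]_t cos (x * t + 0) = c x by apply: eq_Rintegral => t _; rewrite addr0.
have sE x : \int[m]_t cos (x * t + - (pi / 2)) = s x.
  by apply: eq_Rintegral => t _; rewrite cosBpihalf.
have := step 0; have := step (- (pi / 2)).
rewrite !sE !cE addr0 !Rintegral_cos_phase cosBpihalf.
have -> : sin (xi - pi / 2) = - cos xi.
  by rewrite sinB sin_pihalf cos_pihalf; ring.
move=> s3 c3.
have s3' : s (a * xi) = (2 * s xi + (sin xi * c xi - - cos xi * s xi)) / 3.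
  by rewrite -s3; field.
have c3' : c (a * xi) = (2 * c xi + (cos xi * c xi - sin xi * s xi)) / 3.
  by rewrite -c3; field.
rewrite /energy s3' c3'.
have := cos2Dsin2 xi.
move: (cos xi) (sin xi) (c xi) (s xi) => u v x y uv.
rewrite [LHS](_ : _ = (4 + 4 * u + (u ^+ 2 + v ^+ 2)) / 9 * (x ^+ 2 + y ^+ 2)).
  by rewrite uv; field.
by field.
Qed.

(** Iterates [energy_scale], bounding each factor [1 - 4 / 9 * u] below by [expR (- (4 * u))] so
    that the product becomes a sum. *)
Lemma energy_orbit_ge xi n :
  energy xi * expR (- (4 * \sum_(j < n) (1 - cos (xi * a ^+ j)))) <=
  energy (xi * a ^+ n).
Proof.
elim: n => [|n IH].
  by rewrite big_ord0 mulr0 oppr0 expR0 !mulr1.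
rewrite exprSr mulrA [_ * a]mulrC energy_scale big_ord_recr /= mulrDr opprD.
rewrite expRD mulrA mulrC.
set u := 1 - cos _.
have u0 : 0 <= u by rewrite subr_ge0 cos_le1.
have u2 : u <= 2 by have := cos_geN1 (xi * a ^+ n); rewrite /u; lra.
have := @expRN_le_1B R (4 / 9 * u) ltac:(lra) ltac:(lra).
have -> : 9 * (4 / 9 * u) = 4 * u by field.
move=> h; apply: le_trans (ler_wpM2l (expR_ge0 _) IH) _.
by apply: ler_wpM2r h; rewrite addr_ge0 ?sqr_ge0.
Qed.

End self_similar.

Lemma Rintegral_cos_cvg0 (R : realType)
    (m : {finite_measure set (measurableTypeR R) -> \bar R}) (xi : R^nat) :
  xi @ \oo --> 0 ->
  (fun k => \int[m]_x cos (xi k * x)) @ \oo --> fine (m setT).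
Proof.
move=> xi0.
have m_lty : (m setT < +oo)%E by rewrite -ge0_fin_numE// fin_num_measure.
have mcos k : measurable_fun setT (fun x : measurableTypeR R => cos (xi k * x)).
  have := measurable_cos_affine (D := setT) (xi k) 0.
  by under eq_fun do rewrite addr0.
have [] := @dominated_convergence _ _ R m setT measurableT
  (fun k x => (cos (xi k * x))%:E) (cst 1%E) (cst 1%E).
- by move=> k; exact/measurable_EFinP.
- exact: measurable_cst.
- apply: aeW => x _; apply/cvg_EFin.
    by apply: nearW.
  rewrite -(@cos0 R); apply: continuous_cvg; first exact: continuous_cos.
  by rewrite -[X in _ --> X](mul0r x); apply: cvgM => //; exact: cvg_cst.
- exact: finite_measure_integrable_cst.
- by apply: aeW => x k _ /=; rewrite lee_fin cos_max.
move=> _ _; rewrite integral_cst// mul1e -[X in _ --> X](@fineK _) ?fin_num_measure//.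
by move/fine_cvgP => [].
Qed.

Section pisot_self_similar.
Context (R : realType) (a : R).
Context (m : {finite_measure set (measurableTypeR R) -> \bar R}).
Hypothesis pa : pisot a.
Hypothesis ssm : self_similar a m.

Lemma pisot_self_similar_null_dominates :
  m `<< @lebesgue_measure R -> m setT = 0%E.
Proof.
move=> mleb; have a1 : 1 < a by case: pa.
have a0 : 0 < a by exact: lt_trans a1.
have aV1 : `|a^-1| < 1 by rewrite gtr0_norm ?invr_gt0// invf_lt1.
have [K HK] := pisot_cos_summable pa.
have aVn0 : (fun n => a ^- n) @ \oo --> (0 : R).
  have := cvg_geometric 1 aV1; rewrite /geometric /=.
  by under eq_fun do rewrite mul1r exprVn.
have an_oo : (fun n => 2 * pi * a ^+ n) @ \oo --> +oo.
  have tp0 : 0 < 2 * pi :> R by rewrite mulr_gt0// pi_gt0.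
  apply/gtr0_cvgV0; first by apply: nearW => n; rewrite mulr_gt0 ?exprn_gt0.
  rewrite [X in X @ _ --> _](_ : _ = fun n => (2 * pi)^-1 * a ^- n).
    by have := cvgM (cvg_cst (2 * pi)^-1) aVn0; rewrite mulr0; exact.
  by apply/funext => n; rewrite /= invfM.
have F0 : (fun n => energy m (2 * pi * a ^+ n)) @ \oo --> 0.
  have c0 := Riemann_Lebesgue 0 mleb an_oo.
  have s0 := Riemann_Lebesgue (- (pi / 2)) mleb an_oo.
  have eqF n : energy m (2 * pi * a ^+ n) =
      (\int[m]_x cos (2 * pi * a ^+ n * x + 0)) ^+ 2 +
      (\int[m]_x cos (2 * pi * a ^+ n * x + - (pi / 2))) ^+ 2.
    rewrite /energy; congr (_ ^+ 2 + _ ^+ 2); apply: eq_Rintegral => x _;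
    by rewrite ?addr0 ?cosBpihalf.
  under eq_fun do rewrite eqF !expr2.
  by have := cvgD (cvgM c0 c0) (cvgM s0 s0); rewrite mulr0 addr0; exact.
(* From frequency [2 * pi * a ^- k], [k + n] steps lead to [2 * pi * a ^+ n] and cost at most a
   factor [expR (- (4 * K))]. Letting [n] grow, the energy at the end tends to 0. *)
have cle k : (\int[m]_x cos (2 * pi * a ^- k * x)) ^+ 2 <= 0.
  rewrite -(pmulr_lle0 _ (expR_gt0 (- (4 * K)))).
  apply: cvgr_to_ge F0 _; apply: nearW => n.
  have -> : 2 * pi * a ^+ n = 2 * pi * a ^- k * a ^+ (k + n).
    by rewrite exprD -!mulrA mulKf// expf_neq0// gt_eqF.
  apply: le_trans (energy_orbit_ge ssm a1 _ _).
  apply: ler_pM; rewrite ?sqr_ge0 ?expR_ge0//.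
    by rewrite /energy lerDl sqr_ge0.
  by rewrite ler_expR lerN2 ler_pM2l.
have c0 k : \int[m]_x cos (2 * pi * a ^- k * x) = 0.
  by apply/eqP; rewrite -sqrf_eq0; apply/eqP/le_anti; rewrite cle sqr_ge0.
(* As [k] grows the frequency tends to 0, and these vanishing integrals tend to the total mass. *)
have : (fun k => \int[m]_x cos (2 * pi * a ^- k * x)) @ \oo --> fine (m setT).
  apply: Rintegral_cos_cvg0.
  by rewrite -[X in _ --> X](mulr0 (2 * pi)); apply: cvgM => //; exact: cvg_cst.
under eq_fun do rewrite c0.
move/(cvg_unique (@Rhausdorff R) (cvg_cst 0)) => m0.
by rewrite -(@fineK _ (m setT)) ?fin_num_measure// -m0.
Qed.

End pisot_self_similar.

(** * Singularity and absence of atoms *)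

Section maximal_null_set.
Context d (T : measurableType d) (R : realType).
Variables (ref : {measure set T -> \bar R}) (m : {finite_measure set T -> \bar R}).

Lemma fine_measure_le (A B : set T) : measurable A -> measurable B ->
  A `<=` B -> fine (m A) <= fine (m B).
Proof.
move=> mA mB AB; rewrite fine_le ?fin_num_measure//.
by apply: le_measure; rewrite ?inE.
Qed.

(** A countable union of null sets whose masses approach the supremum attains it; a null set
    charging the complement of [Z] would exceed it when joined to [Z]. *)
Lemma exists_maximal_null_set : exists Z : set T,
  [/\ measurable Z, ref Z = 0%E &
      forall A, measurable A -> ref A = 0%E -> m (A `\` Z) = 0%E].
Proof.
pose S := [set fine (m A) | A in [set A | measurable A /\ ref A = 0%E]].
have hasS : has_sup S.
  split; first by exists (fine (m set0)), set0.
  exists (fine (m setT)) => _ [A [mA _] <-].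
  exact: fine_measure_le.
have approx n : exists A, [/\ measurable A, ref A = 0%E &
    sup S - n.+1%:R^-1 < fine (m A)].
  have e0 : 0 < n.+1%:R^-1 :> R by [].
  have [_ [A [mA A0] <-] lA] := sup_adherent e0 hasS.
  by exists A.
have [F FP] := choice approx.
have mF n : measurable (F n) by case: (FP n).
have F0 n : ref (F n) = 0%E by case: (FP n).
pose Z := \bigcup_n F n.
have mZ : measurable Z by exact: bigcup_measurable.
have Z0 : ref Z = 0%E.
  apply: measure_negligible => //; apply: negligible_bigcup => n.
  exact: ((negligibleP ref (mF n)).2 (F0 n)).
exists Z; split => // A mA A0.
have mAZ : measurable (A `\` Z) by exact: measurableD.
have AZ0 : ref (A `|` Z) = 0%E.
  apply: measure_negligible; first exact: measurableU.
  apply: negligibleU; first exact: ((negligibleP ref mA).2 A0).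
  exact: ((negligibleP ref mZ).2 Z0).
have : fine (m (A `|` Z)) <= sup S.
  apply: ub_le_sup; first by case: hasS.
  by exists (A `|` Z) => //; split => //; exact: measurableU.
rewrite (measureDI m (measurableU _ _ mA mZ) mZ) setDUD setDv setU0 setIUl setIid.
rewrite setUidr; last exact: subIsetr.
rewrite fineD ?fin_num_measure// => leS.
suff AZle : fine (m (A `\` Z)) <= 0.
  apply/eqP; rewrite -(@fineK _ (m _)) ?fin_num_measure// eqe eq_le AZle.
  exact: fine_ge0.
rewrite leNgt; apply/negP => /ltr_add_invr[n]; rewrite add0r => nlt.
have [_ _ ltF] := FP n.
have FZ : fine (m (F n)) <= fine (m Z).
  by apply: fine_measure_le => //; exact: bigcup_sup.
have := lt_le_trans ltF FZ; rewrite ltrBlDr => /(le_lt_trans leS).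
by rewrite addrC ltrD2l => /(lt_trans nlt); rewrite ltxx.
Qed.

End maximal_null_set.

Section lebesgue_contraction.
Context (R : realType).
Local Notation leb := (@lebesgue_measure R).

(** The pushforward of Lebesgue measure, scaled by [a^-1], agrees with Lebesgue measure on half-open
    intervals, hence everywhere. *)
Lemma lebesgue_contraction_preimage (a b : R) (A : set (measurableTypeR R)) :
  0 < a -> measurable A -> leb (digit_contraction a b @^-1` A) = (a%:E * leb A)%E.
Proof.
move=> a0 mA.
have aV0 : 0 <= a^-1 by rewrite invr_ge0 ltW.
pose m : {measure set (measurableTypeR R) -> \bar R} := mscale (NngNum aV0)
  (measure_function_pushforward__canonical__measure_function_Measure
    leb (measurable_digit_contraction a b)).
rewrite [in RHS](lebesgue_measure_unique (mu := m) _ mA).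
  by rewrite /m /= /mscale /= muleA -EFinM divff ?mul1e// gt_eqF.
move=> _ [[x y]] _ <-; rewrite /m /= /mscale /= /pushforward.
have -> : digit_contraction a b @^-1` `]x, y]%classic = `]a * x - b, a * y - b]%classic.
  apply/seteqP; split => z /=; rewrite /digit_contraction !in_itv /= ltrBlDr lerBrDr;
  by rewrite ltr_pdivlMl// ler_pdivrMl.
rewrite !lebesgue_measure_itv /= !lte_fin ltrD2r ltr_pM2l//.
case: ifPn => _; last by rewrite mule0.
by rewrite -!EFinB -EFinM; congr (_%:E); field; rewrite gt_eqF.
Qed.

End lebesgue_contraction.

Section self_similar_singular.
Context (R : realType) (a : R).
Context (m : {finite_measure set (measurableTypeR R) -> \bar R}).
Local Notation leb := (@lebesgue_measure R).
Hypothesis pa : pisot a.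
Hypothesis ssm : self_similar a m.

(** Removing [Z] before or after taking preimages gives one inequality in the equation for each set.
    For [A] and its complement both sides total three times the mass outside [Z], so there is no
    slack. *)
Lemma self_similar_restriction (Z : set (measurableTypeR R)) :
  measurable Z -> leb Z = 0%E ->
  (forall A, measurable A -> leb A = 0%E -> m (A `\` Z) = 0%E) ->
  self_similar a (fun A => m (A `&` ~` Z)).
Proof.
move=> mZ Z0 maxZ; have a1 : 1 < a by case: pa.
have a0 : 0 < a by exact: lt_trans a1.
have mpre b A : measurable A -> measurable (digit_contraction a b @^-1` A).
  by move=> mA; rewrite -[X in measurable X]setTI; exact: measurable_digit_contraction.
pose P A := fine (m A).
have PE A : measurable A -> m A = (P A)%:E by move=> mA; rewrite fineK ?fin_num_measure.
have ssP A : measurable A -> P A + (P A + P A) =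
    P (digit_contraction a 0 @^-1` A) +
    (P (digit_contraction a 0 @^-1` A) + P (digit_contraction a 1 @^-1` A)).
  by move=> mA; have := ssm mA; rewrite !PE//; [case|exact: mpre..].
(* The preimage of Z is null, hence m-null outside Z. *)
have le_pre b A : measurable A -> P (digit_contraction a b @^-1` A `\` Z) <=
    P (digit_contraction a b @^-1` (A `\` Z)).
  move=> mA; have mAp := mpre b _ mA; have mZp := mpre b _ mZ.
  have mpD : measurable (digit_contraction a b @^-1` (A `\` Z)).
    by apply: mpre; exact: measurableD.
  have mZpZ : measurable (digit_contraction a b @^-1` Z `\` Z) by exact: measurableD.
  have : P (digit_contraction a b @^-1` A `\` Z) <=
      P (digit_contraction a b @^-1` (A `\` Z) `|` (digit_contraction a b @^-1` Z `\` Z)).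
    apply: fine_measure_le; [exact: measurableD|exact: measurableU|].
    move=> x [Ax nZx]; have [Zx|nZx'] := pselect (Z (digit_contraction a b x)).
      by right.
    by left.
  move=> /le_trans; apply; rewrite -[leRHS]addr0.
  have PZ0 : P (digit_contraction a b @^-1` Z `\` Z) = 0.
    by rewrite /P maxZ// lebesgue_contraction_preimage// Z0 mule0.
  rewrite -PZ0 /P -fineD ?fin_num_measure//; apply: fine_le.
  - by rewrite fin_num_measure//; exact: measurableU.
  - by rewrite fin_numD !fin_num_measure.
  - exact: measureU2.
move=> A mA; have mCA := measurableC mA.
have DC (B : set (measurableTypeR R)) : B `&` ~` Z = B `\` Z by [].
have pC b : digit_contraction a b @^-1` (~` A) = ~` (digit_contraction a b @^-1` A) by [].
have PCD B : measurable B -> P (B `\` Z) + P (~` B `\` Z) = P (~` Z).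
  move=> mB; rewrite /P -fineD ?fin_num_measure//.
  - rewrite -measureU//.
    + by rewrite -setDUD setUv setTD.
    + exact: measurableD.
    + by apply: measurableD => //; exact: measurableC.
    + by apply/seteqP; split => // x [[Bx _] [nBx _]].
  - exact: measurableD.
  - by apply: measurableD => //; exact: measurableC.
have h0 := le_pre 0 _ mA; have h1 := le_pre 1 _ mA.
(* The inequalities for A and ~` A add up to an equality. *)
have k0 := le_pre 0 _ mCA; have k1 := le_pre 1 _ mCA.
rewrite !pC in k0 k1.
have sA := ssP _ (measurableD mA mZ).
have sCA := ssP _ (measurableD mCA mZ).
have t := PCD _ mA; have t0 := PCD _ (mpre 0 _ mA); have t1 := PCD _ (mpre 1 _ mA).
rewrite !DC !PE; try by apply: measurableD => //; exact: mpre.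
rewrite -!EFinD; congr (_%:E).
by move: h0 h1 k0 k1 sA sCA t t0 t1; clear; lra.
Qed.

(** Maximality of [Z] serves twice: it makes the restriction of [m] to the complement of [Z] both
    self-similar and absolutely continuous. *)
Lemma pisot_self_similar_singular :
  exists Z : set (measurableTypeR R), [/\ measurable Z, leb Z = 0%E & m (~` Z) = 0%E].
Proof.
have [Z [mZ Z0 maxZ]] := exists_maximal_null_set leb m.
have mCZ := measurableC mZ.
have CZfin : (m (~` Z) < +oo)%E by rewrite -ge0_fin_numE// fin_num_measure.
exists Z; split => //.
pose nu : {finite_measure set (measurableTypeR R) -> \bar R} := mfrestr mCZ CZfin.
have := @pisot_self_similar_null_dominates R a nu pa.
rewrite /nu /= /mfrestr /mrestr setTI; apply.
  exact: self_similar_restriction.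
by apply/null_content_dominatesP => A mA A0; rewrite -setDE; exact: maxZ.
Qed.

End self_similar_singular.

(** * Absence of atoms *)

Section self_similar_atoms.
Context (R : realType) (a : R).
Context (m : {finite_measure set (measurableTypeR R) -> \bar R}).
Hypothesis a1 : 1 < a.
Hypothesis ssm : self_similar a m.
Let P (x : R) := fine (m [set x]).

Lemma sum_atoms_le (z : nat -> R) n : injective z ->
  \sum_(k < n) P (z k) <= fine (m setT).
Proof.
move=> injz.
have : (\sum_(k < n) m [set z k] <= m setT)%E.
  have mU : measurable (\big[setU/set0]_(k < n) [set z k] : set (measurableTypeR R)).
    by apply: bigsetU_measurable => k _; exact: measurable_set1.
  rewrite -(measure_semi_additive_ord_I m (F := fun k => [set z k]) _ _ mU)//.
    by apply: le_measure; rewrite ?inE.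
  by move=> i j _ _ [x [/= -> /injz]].
rewrite -(@fineK _ (m setT)) ?fin_num_measure//.
under eq_bigr do rewrite -(@fineK _ (m [set _])) ?fin_num_measure//.
by rewrite sumEFin lee_fin.
Qed.

Lemma atom_self_similar x : 3 * P x = 2 * P (a * x) + P (a * x - 1).
Proof.
have a0 : a != 0 by rewrite gt_eqF// (lt_trans _ a1).
have pre b : digit_contraction a b @^-1` [set x] = [set a * x - b].
  apply/seteqP; split => y /=; rewrite /digit_contraction.
    by move=> <-; rewrite mulVKf// addrK.
  by move=> ->; rewrite subrK mulKf.
have := ssm (measurable_set1 x); rewrite !pre subr0.
rewrite -(@fineK _ (m [set x])) ?fin_num_measure//.
rewrite -(@fineK _ (m [set a * x])) ?fin_num_measure//.
rewrite -(@fineK _ (m [set a * x - 1])) ?fin_num_measure//.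
by rewrite -!EFinD => -[]; rewrite /P; lra.
Qed.

(* If the mass at z is within e of the supremum S, then the masses at a z and
   a z - 1 are within 3 e of S; following the orbit a^k z with z <> 0 yields
   arbitrarily many points of mass at least S / 2. *)
Lemma self_similar_atomless x : m [set x] = 0%E.
Proof.
pose S := sup (range P).
have ubP y : P y <= fine (m setT) by apply: fine_measure_le.
have hasS : has_sup (range P).
  by split; [exists (P 0), 0|exists (fine (m setT)) => _ [y _ <-]].
have leS y : P y <= S by apply: ub_le_sup; [case: hasS|exists y].
suff S0 : S <= 0.
  apply/eqP; rewrite -(@fineK _ (m _)) ?fin_num_measure// eqe eq_le.
  by rewrite (le_trans (leS x) S0) fine_ge0.
rewrite leNgt; apply/negP => S0.
have S20 : 0 < S / 2 by rewrite divr_gt0.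
have many n : n%:R * (S / 2) <= fine (m setT).
  (* The loss after [k < n] steps, [3 ^+ k.+1 * e], then stays below [S / 2]. *)
  pose e := S / 2 / 3 ^+ n.+1.
  have e0 : 0 < e by rewrite !divr_gt0// exprn_gt0.
  have [_ [y _ <-] yS] := sup_adherent e0 hasS.
  (* The orbit of 0 is constant; if [y = 0], the equation at 0 gives -1 the same mass. *)
  have [z z0 zS] : exists2 z, z != 0 & S - 3 * e <= P z.
    have [y0|y0] := eqVneq y 0; last by exists y => //; rewrite -/S in yS; lra.
    exists (-1); first by rewrite oppr_eq0 oner_eq0.
    have := atom_self_similar y; rewrite y0 mulr0 sub0r -y0.
    by have := leS y; rewrite -/S in yS; lra.
  have orbit k : S - 3 ^+ k.+1 * e <= P (a ^+ k * z).
    elim: k => [|k IH]; first by rewrite mul1r expr1.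
    have := atom_self_similar (a ^+ k * z); rewrite mulrA -exprS.
    have := leS (a ^+ k.+1 * z - 1); rewrite [3 ^+ k.+2]exprS -mulrA.
    have : 0 < 3 ^+ k.+1 * e by rewrite mulr_gt0// exprn_gt0.
    move: IH; move: (3 ^+ k.+1 * e) => u; lra.
  have inj : injective (fun k => a ^+ k * z).
    by move=> i j /(mulIf z0)/ieexprIn; apply; [exact: lt_trans a1|rewrite gt_eqF].
  apply: le_trans (sum_atoms_le n inj).
  rewrite mulr_natl -[X in _ *+ X]card_ord -sumr_const; apply: ler_sum => k _.
  apply: le_trans (orbit k).
  have : 3 ^+ k.+1 * e <= S / 2.
    rewrite /e mulrCA ler_piMr//; first exact: ltW.
    by rewrite ler_pdivrMr ?exprn_gt0// mul1r ler_eXn2l ?ltr1n// ltnS ltnW.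
  move: (3 ^+ k.+1 * e) => u; lra.
have := archi_boundP (divr_ge0 (fine_ge0 (measure_ge0 m setT)) (ltW S20)).
by rewrite ltr_pdivrMr// ltNge many.
Qed.

End self_similar_atoms.

(** * The plane *)

Section first_marginal.
Context (R : realType) (mu : probability (plane R) R).

Definition marginal1 : set (measurableTypeR R) -> \bar R :=
  pushforward mu (fst : plane R -> measurableTypeR R).

HB.instance Definition _ := Measure.copy marginal1
  (measure_function_pushforward__canonical__measure_function_Measure
    mu measurable_fst).

Let marginal1_fin : fin_num_fun marginal1.
Proof.
move=> A mA; apply: fin_num_measure; rewrite -[X in measurable X]setTI.
exact: measurable_fst.
Qed.

HB.instance Definition _ :=
  Measure_isFinite.Build _ _ _ marginal1 marginal1_fin.

(** The digits have first coordinates 0, 1, 0, whence the multiplicities 2 and 1; the maps act on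
    the first coordinate alone when tested on cylinders over [A]. *)
Lemma marginal1_self_similar (a : R) :
  is_hutchinson_measure (digit_ifs a^-1) mu -> self_similar a marginal1.
Proof.
move=> hmu A mA; pose A2 : set (plane R) := fst @^-1` A.
have mA2 : measurable A2.
  by rewrite -[X in measurable X]setTI; exact: measurable_fst.
have pre (b c : R) : mu (@digit_map R a^-1 (b, c) @^-1` A2) =
    marginal1 (digit_contraction a b @^-1` A) by [].
have fin b : marginal1 (digit_contraction a b @^-1` A) \is a fin_num.
  rewrite fin_num_measure// -[X in measurable X]setTI.
  exact: measurable_digit_contraction.
have := hmu _ mA2; rewrite /digit_ifs /digits /= !big_cons big_nil /pushforward.
rewrite !pre adde0 -[mu A2]/(marginal1 A).
have finA : marginal1 A \is a fin_num by rewrite fin_num_measure.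
rewrite -(fineK finA) -(fineK (fin 0)) -(fineK (fin 1)).
by rewrite -!EFinD -EFinM => -[->]; congr (_%:E); field.
Qed.

End first_marginal.

Theorem corollary4p2 (R : realType) (alpha : R)
    (mu : probability (plane R) R) :
  pisot alpha ->
  is_hutchinson_measure (digit_ifs alpha^-1) mu ->
  ~ (mu `<< @lebesgue2 R) /\ purely_continuous_singular (@lebesgue2 R) mu.
Proof.
move=> pa /marginal1_self_similar ssm; have a1 : 1 < alpha by case: pa.
have [Z [mZ Z0 muCZ]] := pisot_self_similar_singular pa ssm.
(* The cylinder over [Z] is Lebesgue-null and carries all of [mu]. *)
pose N : set (plane R) := Z `*` setT.
have mN : measurable N by exact: measurableX.
have NE : N = fst @^-1` Z by apply/seteqP; split => -[x y] /=; [case|].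
have N0 : @lebesgue2 R N = 0%E.
  rewrite /lebesgue2 product_measure1E//.
  by rewrite [X in (X * _)%E]Z0 mul0e.
have muCN : mu (~` N) = 0%E by rewrite NE.
split.
  move=> /null_content_dominatesP/(_ _ mN N0) muN.
  have := measureU mu mN (measurableC mN) (setICr N).
  rewrite setUv => muT; have := etrans (esym (probability_setT mu)) muT.
  by rewrite [X in (X + _)%E]muN [X in (_ + X)%E]muCN adde0 => -[/eqP]; rewrite oner_eq0.
split; last first.
  (* A point lies on the vertical line through it, whose mass is that of an atom of the marginal. *)
  move=> A mA; apply: esum1 => x _; apply/eqP; rewrite eq_le measure_ge0 andbT.
  rewrite -[leRHS](self_similar_atomless a1 ssm x.1).
  rewrite -[leRHS]/(mu (fst @^-1` [set x.1])); apply: le_measure; rewrite ?inE.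
  - have -> : [set x] = [set x.1] `*` [set x.2].
      by apply/seteqP; split => [y ->|y [/= y1 y2]] //; apply/eqP/andP; split; apply/eqP.
    by apply: measurableX; exact: measurable_set1.
  - by rewrite -[X in measurable X]setTI; exact: measurable_fst.
  - by move=> y ->.
split; first by apply/null_content_dominatesP.
(* The singular part is [mu] itself, separated from Lebesgue measure by the complement of [N]. *)
exists mu; last by move=> A _; rewrite /mzero add0e.
by exists (~` N); rewrite setCK; split => //; exact: measurableC.
Qed.
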